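(* Let $(\rho^n,\boldsymbol u^n,\phi^n)\in L_{\mathcal M}(\Omega)\times\boldsymbol H_{\mathcal E,0}(\Omega)\times L_{\mathcal M}(\Omega)$, with $\rho^n_K>0$ for all $K\in\mathcal M$. Then there exists a solution $(\rho^{n+1},\boldsymbol u^{n+1},\phi^{n+1})\in L_{\mathcal M}(\Omega)\times\boldsymbol H_{\mathcal E,0}(\Omega)\times L_{\mathcal M}(\Omega)$ of the scheme (S1)-(S3) given in the context.
   Context: Thermodynamics. $\gamma\ge1$, $p(\rho)=\rho^\gamma$; for $\rho>0$, $\psi_1(\rho)=\rho\ln\rho$ and $\psi_\gamma(\rho)=\rho^\gamma/(\gamma-1)$ if $\gamma>1$. $\varepsilon\in(0,1]$ is the scaled Debye length. MAC mesh. $\Omega\subset\mathbb R^d$ ($d=2,3$) is open, bounded, connected and its closure is a union of closed axis-parallel rectangles ($d=2$) or parallelepipeds ($d=3$). $\mathcal M$ is a (structured, possibly non-uniform) partition of $\bar\Omega$ into closed axis-parallel rectangles/parallelepipeds $K$; $\mathcal E$ is the set of edges (faces) of the cells; $\mathcal E^{(i)}=\mathcal E^{(i)}_{\mathrm{int}}\cup\mathcal E^{(i)}_{\mathrm{ext}}$ are the internal and external edges orthogonal to the $i$-th canonical basis vector $\boldsymbol e^{(i)}$; $\mathcal E(K)$ is the set of edges of $K$; $\sigma=K|L$ means $\sigma$ is the common edge of $K$ and $L$. $|\cdot|$ denotes $d$- or $(d-1)$-dimensional measure. $D_{\sigma,K}$ is the half of $K$ adjacent to $\sigma\in\mathcal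 E(K)$; the dual cell is $D_\sigma=D_{\sigma,K}\cup D_{\sigma,L}$ for $\sigma=K|L$ and $D_\sigma=D_{\sigma,K}$ for external $\sigma\in\mathcal E(K)$. $\tilde{\mathcal E}(D_\sigma)$ is the set of edges of $D_\sigma$ ($\epsilon=D_\sigma|D_{\sigma'}$ denotes the edge common to $D_\sigma$ and $D_{\sigma'}$, for $\sigma,\sigma'$ in the same $\mathcal E^{(i)}$). $\boldsymbol\nu_{\sigma,K}$ is the unit normal to $\sigma$ outward to $K$. Boundary conditions. $\partial\Omega=\Gamma^D\cup\Gamma^N$ (disjoint, each external edge being contained in one of the two parts); the potential satisfies $\phi=\phi^D$ on $\Gamma^D$, with $\phi^D\in L^\infty(\Omega)\cap H^1(\Omega)$ given, and $\nabla\phi\cdot\boldsymbol\nu=0$ on $\Gamma^N$. Discrete unknowns. $L_{\mathcal M}(\Omega)$: scalar functions constant on each $K$. $\boldsymbol H_{\mathcal E,0}(\Omega)$: vector fields whose $i$-th component is constant on each $D_\sigma$, $\sigma\in\mathcal E^{(i)}$ (value $v_\sigma$), and zero for external $\sigma$. For $\sigma\in\mathcal E^{(i)}\cap\mathcal E(K)$, $v_{\sigma,K}=v_\sigma\,\boldsymbol e^{(i)}\cdot\boldsymbol\nu_{\sigma,K}$. For $q\in L_{\mathcal M}(\Omega)$ and $\sigma=K|L$: $|D_\sigma|q_{D_\sigma}=|D_{\sigma,K}|q_K+|D_{\sigma,L}|q_L$. For $\sigma\in\mathcal E(K)\cap\mathcal E^{(i)}$, $(\partial^{(i)}_{\mathcal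 E}q)_\sigma=\frac{|\sigma|}{|D_\sigma|}(q_{K_\sigma}-q_K)\,\boldsymbol e^{(i)}\cdot\boldsymbol\nu_{\sigma,K}$, where $q_{K_\sigma}=q_L$ if $\sigma=K|L$, $q_{K_\sigma}=q_K$ if $\sigma\subset\Gamma^N$, and $q_{K_\sigma}=\frac1{|\sigma|}\int_\sigma q^D$ if $\sigma\subset\Gamma^D$, $q^D$ being the boundary value of $q$ (so $\phi^D$ for $q=\phi$). $(\mathrm{div}_{\mathcal M}\boldsymbol v)_K=\frac1{|K|}\sum_{\sigma\in\mathcal E(K)}|\sigma|v_{\sigma,K}$. $(\Delta_{\mathcal M}q)_K=(\mathrm{div}_{\mathcal M}(\nabla_{\mathcal E}q))_K$ with $\nabla_{\mathcal E}q=(\partial^{(1)}_{\mathcal E}q,\dots,\partial^{(d)}_{\mathcal E}q)$. Interface density: for $\sigma=K|L$, $\rho_\sigma=(\rho_K^\gamma-\rho_L^\gamma)/(\psi_\gamma'(\rho_K)-\psi_\gamma'(\rho_L))$ if $\rho_K\ne\rho_L$, and $\rho_\sigma=\rho_K$ otherwise. Scheme. $\delta t>0$; given $(\rho^n,\boldsymbol u^n,\phi^n)$, with $p^n=p(\rho^n)$: (S1) $\frac1{\delta t}(\rho_K^{n+1}-\rho_K^n)+\frac1{|K|}\sum_{\sigma\in\mathcal E(K)}F^n_{\sigma,K}=0$ for all $K\in\mathcal M$; (S2) $\frac1{\delta t}(\rho^{n+1}_{D_\sigma}u^{n+1}_\sigma-\rho^n_{D_\sigma}u^n_\sigma)+\frac1{|D_\sigma|}\sum_{\epsilon\in\tilde{\mathcal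 E}(D_\sigma)}F^n_{\epsilon,\sigma}u^n_{\epsilon,\mathrm{up}}+(\partial^{(i)}_{\mathcal E}p^n)_\sigma=\rho^n_\sigma(\partial^{(i)}_{\mathcal E}(\phi^{n+1}-\Lambda^n))_\sigma$ for all $\sigma\in\mathcal E^{(i)}_{\mathrm{int}}$, $1\le i\le d$; (S3) $\varepsilon^2(\Delta_{\mathcal M}\phi^{n+1})_K=\rho^{n+1}_K-1$ for all $K\in\mathcal M$. Here $F^n_{\sigma,K}=|\sigma|(\rho^n_\sigma u^n_{\sigma,K}-Q^{n+1}_{\sigma,K})$ (zero for external $\sigma$), $\boldsymbol Q^{n+1}\in\boldsymbol H_{\mathcal E,0}(\Omega)$ with $Q^{n+1}_\sigma=\eta_\sigma\delta t\,\rho^n_\sigma\big((\partial^{(i)}_{\mathcal E}p^n)_\sigma-\rho^n_\sigma(\partial^{(i)}_{\mathcal E}\phi^{n+1})_\sigma\big)$ for $\sigma\in\mathcal E^{(i)}_{\mathrm{int}}$, where $\eta_\sigma>0$ are coefficients known at time $t_n$ (in the paper, $\eta_\sigma=\eta/\rho^n_{D_\sigma}$ with a constant $\eta>5/4$), and $\Lambda^n_K=-\alpha\,\delta t\,\frac{C}{|K|}\sum_{\sigma\in\mathcal E(K)}|\sigma|\rho^n_\sigma u^n_{\sigma,K}$ with constants $\alpha\ge2$, $C>0$ ($C$ an upper bound of $\psi_\gamma''$). The dual fluxes $F^n_{\epsilon,\sigma}$ are zero for $\epsilon\subset\partial\Omega$ and otherwise are the standard MAC combinations: if $\epsilon=D_\sigma|D_{\sigma'}\subset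 K$ is parallel to $\sigma,\sigma'\in\mathcal E(K)$, $F_{\epsilon,\sigma}=\frac12(F_{\sigma',K}-F_{\sigma,K})$; if $\epsilon$ is orthogonal to $\sigma=K|L$ and is contained in $\tau\cup\tau'$ with $\tau\in\mathcal E(K)$, $\tau'\in\mathcal E(L)$, $F_{\epsilon,\sigma}=\frac12(F_{\tau,K}+F_{\tau',L})$. The upwind value for $\epsilon=D_\sigma|D_{\sigma'}$ is $u_{\epsilon,\mathrm{up}}=u_\sigma$ if $F_{\epsilon,\sigma}\ge0$ and $u_{\sigma'}$ otherwise.
   Formalization: Two assumptions are added, without which the claim can fail: some external edge lies in Γ^D or Σ|K|ρ^n_K = Σ|K|; and for every (ρ^{n+1}, φ^{n+1}) solving (S1) and (S3), the dual densities ρ^{n+1}_{D_σ} at internal σ are nonzero. *)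

(* Defs.v *)
From mathcomp Require Import all_boot all_order all_algebra.
From mathcomp Require Import all_classical all_reals all_analysis.

Set Implicit Arguments.
Unset Strict Implicit.
Unset Printing Implicit Defensive.

Import Order.TTheory GRing.Theory Num.Theory.
Import numFieldNormedType.Exports.

Local Open Scope classical_set_scope.
Local Open Scope ring_scope.

Section Boxes.
Variables (R : realType) (d : nat).
Implicit Types (B : 'rV[R]_d * 'rV[R]_d) (x : 'rV[R]_d).

(* A box is the pair (lower corner, upper corner). *)
Definition box : Type := ('rV[R]_d * 'rV[R]_d)%type.

Definition box_set (B : box) : set 'rV[R]_d :=
  [set x | forall i, B.1 ord0 i <= x ord0 i <= B.2 ord0 i].

Definition set_coord x (i : 'I_d) (t : R) : 'rV[R]_d :=
  \row_j (if j == i then t else x ord0 j).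

(* The face of B orthogonal to e_i; the outward normal is + e_i if s = true and
   - e_i if s = false. It is itself a box, degenerate in the direction i. *)
Definition face (B : box) (i : 'I_d) (s : bool) : box :=
  let t := (if s then B.2 else B.1) ord0 i in
  (set_coord B.1 i t, set_coord B.2 i t).

Definition face_relint (B : box) (i : 'I_d) (s : bool) : set 'rV[R]_d :=
  [set x | x ord0 i = (if s then B.2 else B.1) ord0 i /\
           forall j, j != i -> B.1 ord0 j < x ord0 j < B.2 ord0 j].

End Boxes.

(* The partition is conforming: two distinct cells which meet do so along a
   common vertex, edge or face, i.e. in each direction their extents are equal
   or have just an endpoint in common. A cell-to-cell interface therefore is a
   whole face of both cells, and it is not part of the boundary of Omega. *)
Record mac_mesh (R : realType) (d : nat) (Omega : set 'rV[R]_d) := MacMesh {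
  cell : finType;
  cell_box : cell -> box R d;
  cell_box_inj : injective cell_box;
  cell_box_nondeg : forall K i,
    (cell_box K).1 ord0 i < (cell_box K).2 ord0 i;
  cell_cover : closure Omega = \bigcup_(K in [set: cell]) box_set (cell_box K);
  cell_conforming : forall K L, K != L ->
    box_set (cell_box K) `&` box_set (cell_box L) !=set0 ->
    forall i,
    [\/ (cell_box K).1 ord0 i = (cell_box L).1 ord0 i /\
        (cell_box K).2 ord0 i = (cell_box L).2 ord0 i,
        (cell_box K).2 ord0 i = (cell_box L).1 ord0 i |
        (cell_box L).2 ord0 i = (cell_box K).1 ord0 i];
  cell_interface : forall K L i,
    face (cell_box K) i true = face (cell_box L) i false ->
    face_relint (cell_box K) i true `<=` Omega
}.

Section Edges.
Variables (R : realType) (d : nat) (Omega : set 'rV[R]_d) (M : mac_mesh Omega).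

Definition edge_seq : seq (box R d) :=
  [seq face (cell_box x.1.1) x.1.2 x.2 | x : cell M * 'I_d * bool].

Definition edge : finType := seq_sub edge_seq.

Lemma side_edge_subproof (K : cell M) (i : 'I_d) (s : bool) :
  face (cell_box K) i s \in edge_seq.
Proof. by apply/codomP; exists (K, i, s). Qed.

(* The edges of K are the [side_edge K i s]; the two sides of an interface K|L
   give the same element of [edge]. Below, a triple (K, i, s) stands for the
   pair (sigma, K) with sigma = side_edge K i s in E(K) and in E^(i). *)
Definition side_edge (K : cell M) (i : 'I_d) (s : bool) : edge :=
  SeqSub (side_edge_subproof K i s).

(* [Some L] if sigma = K|L, and [None] if sigma is external. *)
Definition nbr (K : cell M) (i : 'I_d) (s : bool) : option (cell M) :=
  [pick L | face (cell_box L) i (~~ s) == face (cell_box K) i s].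

(* e^(i) . nu_{sigma,K} *)
Definition nsgn (s : bool) : R := if s then 1 else -1.

Definition extent (K : cell M) (i : 'I_d) : R :=
  (cell_box K).2 ord0 i - (cell_box K).1 ord0 i.

Definition vol (K : cell M) : R := \prod_i extent K i.
Definition area (K : cell M) (i : 'I_d) : R := \prod_(j | j != i) extent K j.
Definition dual_vol (K : cell M) (i : 'I_d) (s : bool) : R :=
  vol K / 2 + (if nbr K i s is Some L then vol L / 2 else 0).

(* d Omega is split into GammaD and GammaN; since edges are closed and the two
   parts are disjoint, only the relative interior of an external edge can be
   asked to lie in one of them. *)
Definition boundary_partition (GammaD GammaN : set 'rV[R]_d) : Prop :=
  [/\ closure Omega `\` interior Omega = GammaD `|` GammaN,
      GammaD `&` GammaN = set0 &
      forall K i s, nbr K i s = None ->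
        face_relint (cell_box K) i s `<=` GammaD \/
        face_relint (cell_box K) i s `<=` GammaN].

Definition dirichlet_side (GammaD : set 'rV[R]_d)
    (K : cell M) (i : 'I_d) (s : bool) : Prop :=
  nbr K i s = None /\ face_relint (cell_box K) i s `<=` GammaD.

End Edges.

Section BoundaryDatum.
Variables (R : realType) (d : nat).

(* Lebesgue integral in the coordinates listed in cs, the other ones being
   those of x. *)
Fixpoint iterated_integral (cs : seq 'I_d) (f : 'rV[R]_d -> \bar R)
    (x : 'rV[R]_d) : \bar R :=
  if cs is i :: cs' then
    (\int[lebesgue_measure]_(t in [set: R])
       iterated_integral cs' f (set_coord x i t))%E
  else f x.

Definition space_integral (A : set 'rV[R]_d) (f : 'rV[R]_d -> R) : \bar R :=
  iterated_integral (enum 'I_d) (fun x => (f x * \1_A x)%:E) 0.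

Variables (Omega : set 'rV[R]_d) (M : mac_mesh Omega).

Definition edge_integral (f : 'rV[R]_d -> R)
    (K : cell M) (i : 'I_d) (s : bool) : R :=
  fine (iterated_integral [seq j <- enum 'I_d | j != i]
          (fun x => (f x * \1_(face_relint (cell_box K) i s) x)%:E)
          (face (cell_box K) i s).1).

Definition edge_mean (f : 'rV[R]_d -> R)
    (K : cell M) (i : 'I_d) (s : bool) : R :=
  (area K i)^-1 * edge_integral f K i s.

Definition borel_on (A : set 'rV[R]_d) (f : 'rV[R]_d -> R) : Prop :=
  let point_of (t : d.-tuple (measurableTypeR R)) : 'rV[R]_d :=
    \row_i (tnth t i) in
  measurable_fun (point_of @^-1` A)
    (fun t => f (point_of t) : measurableTypeR R).

Definition partial (i : 'I_d) (f : 'rV[R]_d -> R) (x : 'rV[R]_d) : R :=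
  'D_(delta_mx ord0 i : 'rV[R]_d) f x.

Definition test_function (w : 'rV[R]_d -> R) : Prop :=
  [/\ forall i x, derivable w x (delta_mx ord0 i : 'rV[R]_d),
      forall i, continuous (partial i w) &
      bounded_set [set x | w x != 0]].

(* [f] is a representative of an element of L^oo(Omega) /\ H^1(Omega) whose
   values on d Omega are those of its trace: Green's formula against C^1_c(R^d)
   says both that g is the weak gradient of f in Omega (take w supported in
   Omega) and that f is its own trace on the external edges. *)
Definition Linfty_H1 (f : 'rV[R]_d -> R) : Prop :=
  [/\ borel_on (closure Omega) f,
      exists c : R, forall x, closure Omega x -> `|f x| <= c &
      exists g : 'I_d -> 'rV[R]_d -> R, forall i,
      [/\ borel_on Omega (g i),
          (space_integral Omega (fun x => g i x ^+ 2)%R < +oo)%E &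
          forall w, test_function w ->
          space_integral Omega (fun x => f x * partial i w x + g i x * w x) =
          (\sum_(K : cell M) \sum_(s : bool | nbr K i s == None)
             nsgn R s * edge_integral (fun x => f x * w x) K i s)%:E]].

End BoundaryDatum.

Section Thermodynamics.
Variables (R : realType) (gamma : R).

Definition pressure (r : R) : R := r `^ gamma.

Definition psi (r : R) : R :=
  if gamma == 1 then r * ln r else r `^ gamma / (gamma - 1).

End Thermodynamics.

Section Operators.
Variables (R : realType) (d : nat) (Omega : set 'rV[R]_d) (M : mac_mesh Omega).

(* Piecewise constant fields are represented by their cell, resp. edge, values. *)
Definition scalar_field := {ffun cell M -> R}.
Definition vector_field := {ffun edge M -> R}.

Definition in_HE0 (v : vector_field) : Prop :=
  forall K i s, nbr K i s = None -> v (side_edge K i s) = 0.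

(* v_{sigma,K} *)
Definition normal_comp (v : vector_field) (K : cell M) (i : 'I_d) (s : bool)
  : R := v (side_edge K i s) * nsgn R s.

(* q_{D_sigma} *)
Definition dual_average (q : scalar_field) (K : cell M) (i : 'I_d) (s : bool)
  : R :=
  if nbr K i s is Some L then
    (vol K / 2 * q K + vol L / 2 * q L) / dual_vol K i s
  else q K.

(* The discrete derivative at sigma, the value beyond sigma being b. *)
Definition edge_diff (q : cell M -> R) (K : cell M) (i : 'I_d) (s : bool)
    (b : R) : R :=
  area K i / dual_vol K i s * (b - q K) * nsgn R s.

Definition pderiv_int (q : cell M -> R) (K : cell M) (i : 'I_d) (s : bool)
  : R := if nbr K i s is Some L then edge_diff q K i s (q L) else 0.

(* q_{K_sigma}, with boundary value qD *)
Definition outer_value (GammaD : set 'rV[R]_d) (qD : 'rV[R]_d -> R)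
    (q : cell M -> R) (K : cell M) (i : 'I_d) (s : bool) : R :=
  if nbr K i s is Some L then q L
  else if `[< face_relint (cell_box K) i s `<=` GammaD >]
  then edge_mean qD K i s else q K.

Definition pderiv (GammaD : set 'rV[R]_d) (qD : 'rV[R]_d -> R)
    (q : cell M -> R) (K : cell M) (i : 'I_d) (s : bool) : R :=
  edge_diff q K i s (outer_value GammaD qD q K i s).

Definition laplacian (GammaD : set 'rV[R]_d) (qD : 'rV[R]_d -> R)
    (q : cell M -> R) (K : cell M) : R :=
  (vol K)^-1 * \sum_(i < d) \sum_(s : bool)
    area K i * (pderiv GammaD qD q K i s * nsgn R s).

(* rho_sigma; the value at external edges is a dummy, as it is only ever
   multiplied by a normal velocity that vanishes there. *)
Definition interface_density (gamma : R) (rho : scalar_field)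
    (K : cell M) (i : 'I_d) (s : bool) : R :=
  if nbr K i s is Some L then
    if rho K == rho L then rho K
    else (rho K `^ gamma - rho L `^ gamma) /
         (derive1 (psi gamma) (rho K) - derive1 (psi gamma) (rho L))
  else rho K.

End Operators.

Section Scheme.
Variables (R : realType) (d : nat) (Omega : set 'rV[R]_d) (M : mac_mesh Omega).
Variables (GammaD : set 'rV[R]_d) (phiD : 'rV[R]_d -> R).
Variables (gamma eps dt alpha C : R) (eta : edge M -> R).

(* (rho, u) is the state at time n and (rho', u', phi') that at time n+1. *)
Variables (rho : scalar_field M) (u : vector_field M).

Let p (K : cell M) : R := pressure gamma (rho K).

(* Q^{n+1}_sigma *)
Definition stabilisation (phi' : scalar_field M) (K : cell M) (i : 'I_d) (s : bool) : R :=
  if nbr K i s is Some _ then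
    let rs := interface_density gamma rho K i s in
    eta (side_edge K i s) * dt * rs *
      (pderiv_int p K i s - rs * pderiv_int phi' K i s)
  else 0.

(* F^n_{sigma,K} *)
Definition mass_flux (phi' : scalar_field M) (K : cell M) (i : 'I_d) (s : bool) : R :=
  if nbr K i s is Some _ then
    area K i * (interface_density gamma rho K i s * normal_comp u K i s
                - stabilisation phi' K i s * nsgn R s)
  else 0.

(* Lambda^n_K *)
Definition Lambda (K : cell M) : R :=
  - (alpha * dt * (C / vol K * \sum_(i < d) \sum_(s : bool)
       area K i * (interface_density gamma rho K i s * normal_comp u K i s))).

Definition upwind (F v w : R) : R := if 0 <= F then v else w.

(* Convection through the dual face contained in K, between
   sigma = side_edge K i s and the opposite edge of K. *)
Definition parallel_convection (phi' : scalar_field M) (K : cell M) (i : 'I_d) (s : bool) : R :=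
  let F := (mass_flux phi' K i (~~ s) - mass_flux phi' K i s) / 2 in
  F * upwind F (u (side_edge K i s)) (u (side_edge K i (~~ s))).

(* u_{sigma'}, for sigma' the edge next to sigma = K|L (L on the positive side)
   in the direction (j, t). At a reentrant corner only one of K, L has a
   neighbour there, and sigma' is an external edge of it. If neither has, then
   the dual face is on d Omega, where the flux is zero. *)
Definition lateral_value (K L : cell M) (i j : 'I_d) (t : bool) : R :=
  if nbr K j t is Some K' then u (side_edge K' i true)
  else if nbr L j t is Some L' then u (side_edge L' i false)
  else 0.

(* Convection through the dual face contained in the union of
   side_edge K j t and side_edge L j t. *)
Definition lateral_convection (phi' : scalar_field M) (K L : cell M) (i j : 'I_d) (t : bool) : R :=
  let F := (mass_flux phi' K j t + mass_flux phi' L j t) / 2 in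
  F * upwind F (u (side_edge K i true)) (lateral_value K L i j t).

Definition convection (phi' : scalar_field M) (K L : cell M) (i : 'I_d) : R :=
  parallel_convection phi' K i true + parallel_convection phi' L i false +
  \sum_(j < d | j != i) \sum_(t : bool) lateral_convection phi' K L i j t.

Definition mass_balance (rho' phi' : scalar_field M) : Prop :=
  forall K : cell M,
    (rho' K - rho K) / dt +
    (vol K)^-1 * \sum_(i < d) \sum_(s : bool) mass_flux phi' K i s = 0.

(* Each internal edge is written once, as sigma = K|L with L on the
   positive side. *)
Definition momentum_balance (rho' : scalar_field M) (u' : vector_field M)
    (phi' : scalar_field M) : Prop :=
  forall (K L : cell M) (i : 'I_d), nbr K i true = Some L ->
    let sigma := side_edge K i true in
    (dual_average rho' K i true * u' sigma
     - dual_average rho K i true * u sigma) / dt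
    + (dual_vol K i true)^-1 * convection phi' K L i
    + pderiv_int p K i true
    = interface_density gamma rho K i true *
      pderiv_int (fun K' => phi' K' - Lambda K') K i true.

Definition poisson (rho' phi' : scalar_field M) : Prop :=
  forall K : cell M,
    eps ^+ 2 * laplacian GammaD phiD phi' K = rho' K - 1.

End Scheme.

(* Main.v *)
From HB Require Import structures.
Require Import Defs.
From mathcomp Require Import all_boot all_order all_algebra.
From mathcomp Require Import all_classical all_reals all_analysis.
From mathcomp Require Import ring lra.
Import Order.TTheory GRing.Theory Num.Theory.
Import numFieldNormedType.Exports.
Set Implicit Arguments.
Unset Strict Implicit.
Unset Printing Implicit Defensive.

Local Open Scope classical_set_scope.
Local Open Scope ring_scope.

(** Why a solution exists. The fluxes at the new time depend on the unknowns
only through phi^(n+1), and affinely. The mass balance therefore gives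
rho^(n+1) as an affine function of phi^(n+1); inserting it in the Poisson
equation leaves a square linear system for phi^(n+1) alone. Because the
stabilisation Q contains - eta dt rho_sigma^2 times the derivative of
phi^(n+1), it adds a second discrete Laplacian with the same sign as the one
of the Poisson equation, and the system reads

  sum over L of w(K,L) (phi_K - phi_L) + kappa(K) phi_K = b(K),

with w symmetric, w(K,L) > 0 as soon as K and L share a face, and kappa(K) > 0
exactly on the cells that have a Dirichlet face. This is a Poisson problem on a
weighted graph ([graph_poisson]): the energy identity shows that an element of
the kernel is constant on a connected graph, and zero if kappa is not
identically zero. With a Dirichlet face the system is thus invertible.
Otherwise the kernel consists of the constants and the image of the data with
zero sum; the sum of b is zero because the explicit fluxes are conservative and
the total mass of rho^n is the volume of the domain.

All this needs the graph of the cells to be connected ([mesh_connected]), which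
is where the topology of Omega enters. Around a point of Omega the cells that
contain it cover a neighbourhood, and one can go from one of them to any other
one by changing the extent in one coordinate direction at a time, thus through
faces ([cells_at_point_connected]). Hence the union of the cells of a component
of the graph and the union of all other cells do not meet in Omega; both are
closed, and since Omega is connected the second one is empty.

Finally, once rho^(n+1) and phi^(n+1) are known, the momentum balance is
explicit: every internal edge carries one equation, in which u^(n+1) is
multiplied by a nonzero dual density ([velocity_exists]). *)

(** * Poisson problems on weighted graphs *)

Lemma injective_linear_onto (R : fieldType) (T : finType)
    (F : (T -> R) -> T -> R) :
  (forall a x y K, F (fun L => a * x L + y L) K = a * F x K + F y K) ->
  (forall v, (forall K, F v K = 0) -> forall K, v K = 0) ->
  forall b, exists v, forall K, F v K = b K.
Proof.
move=> F_lin F_inj b.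
pose V : vectType R := {ffun T -> R^o}.
pose ev (v : V) : T -> R := fun K => v K.
pose op (v : V) : V := [ffun K => F (ev v) K].
have opE v : F (ev v) = ev (op v) by apply/funext => K; rewrite /ev ffunE.
have ev_inj v v' : (forall K, ev v K = ev v' K) -> v = v' by move=> ?; apply/ffunP.
have ev_lin a v v' : ev (a *: v + v') = fun K => a * ev v K + ev v' K.
  by apply/funext => K; rewrite /ev !ffunE.
have ev0 K : ev 0 K = 0 by rewrite /ev ffunE.
have op_lin : linear op.
  move=> a x y; apply: ev_inj => K.
  by rewrite -opE ev_lin F_lin ev_lin !opE.
pose opL : {linear V -> V} := HB.pack op (GRing.isLinear.Build _ _ _ _ op op_lin).
have ker0 : (lker (linfun opL) == 0)%VS.
  rewrite -subv0; apply/subvP => v; rewrite memv_ker lfunE => /eqP opv0.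
  rewrite memv0; apply/eqP/ev_inj => K; rewrite ev0; apply: F_inj => L.
  by rewrite opE (_ : op v = 0) ?ev0.
pose bV : V := [ffun K => b K].
have /memv_imgP[v _ vE] : bV \in (linfun opL @: fullv)%VS.
  by rewrite (lker0_limgf ker0) memvf.
exists (ev v) => K; rewrite opE; have -> : op v = bV.
  by rewrite vE lfunE.
by rewrite /ev ffunE.
Qed.

Lemma sum_antisym (R : realFieldType) (T : finType) (g : T -> T -> R) :
  (forall K L, g L K = - g K L) -> \sum_K \sum_L g K L = 0.
Proof.
move=> g_anti; suff : \sum_K \sum_L g K L = - \sum_K \sum_L g K L by lra.
rewrite [LHS]exchange_big -sumrN; apply: eq_bigr => K _.
by rewrite -sumrN; apply: eq_bigr => L _.
Qed.

Section GraphPoisson.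
Variables (R : realType) (T : finType) (w : T -> T -> R) (kappa : T -> R).
Hypotheses (w_sym : forall K L, w K L = w L K) (w_ge0 : forall K L, 0 <= w K L).
Hypothesis kappa_ge0 : forall K, 0 <= kappa K.
Hypothesis w_connected : forall v : T -> R,
  (forall K L, 0 < w K L -> v K = v L) -> forall K L, v K = v L.

(** Summation by parts: exchanging K and L and averaging turns each flux
w(K,L) (v_K - v_L) into a square. *)
Lemma dirichlet_form (v : T -> R) :
  2 * (\sum_K v K * \sum_L w K L * (v K - v L)) =
  \sum_K \sum_L w K L * (v K - v L) ^+ 2.
Proof.
have -> : \sum_K v K * (\sum_L w K L * (v K - v L)) =
          \sum_K \sum_L w K L * (v K * (v K - v L)).
  by apply: eq_bigr => K _; rewrite mulr_sumr; apply: eq_bigr => L _; ring.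
rewrite mulr_natl mulr2n {2}exchange_big -big_split; apply: eq_bigr => K _.
rewrite -big_split; apply: eq_bigr => L _ /=.
by rewrite (w_sym L K); ring.
Qed.

Lemma energy_eq0_constant (v : T -> R) :
  \sum_K v K * (\sum_L w K L * (v K - v L)) + \sum_K kappa K * v K ^+ 2 = 0 ->
  (forall K L, v K = v L) /\ (forall K, kappa K * v K ^+ 2 = 0).
Proof.
move=> energy0.
have form_ge0 K L : 0 <= w K L * (v K - v L) ^+ 2 by rewrite mulr_ge0 ?sqr_ge0.
have abs_ge0 K : 0 <= kappa K * v K ^+ 2 by rewrite mulr_ge0 ?sqr_ge0.
have := dirichlet_form v.
have : 0 <= \sum_K \sum_L w K L * (v K - v L) ^+ 2.
  by apply: sumr_ge0 => K _; apply: sumr_ge0.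
have : 0 <= \sum_K kappa K * v K ^+ 2 by apply: sumr_ge0.
move=> sum_abs_ge0 sum_form_ge0 sum_formE.
have sum_form0 : \sum_K \sum_L w K L * (v K - v L) ^+ 2 = 0 by lra.
have sum_abs0 : \sum_K kappa K * v K ^+ 2 = 0 by lra.
split; last by move=> K; exact: (psumr_eq0P (fun K _ => abs_ge0 K) sum_abs0).
apply: w_connected => K L wKL.
have row_ge0 K' : true -> 0 <= \sum_L' w K' L' * (v K' - v L') ^+ 2.
  by move=> _; apply: sumr_ge0.
have /(_ K isT) row0 := psumr_eq0P row_ge0 sum_form0.
have /(_ L isT)/eqP := psumr_eq0P (fun L' _ => form_ge0 K L') row0.
by rewrite mulf_eq0 gt_eqF //= sqrf_eq0 subr_eq0 => /eqP.
Qed.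

(** When kappa vanishes the operator kills the constants and its image lies in
the data with zero sum. Adding the sum of v as a rank one perturbation makes it
invertible without changing the solutions: summing the perturbed equations over
K shows that the solution has zero sum when b does. *)
Theorem graph_poisson (b : T -> R) :
  (exists K, 0 < kappa K) \/ (forall K, kappa K = 0) /\ \sum_K b K = 0 ->
  exists v : T -> R, forall K,
    \sum_L w K L * (v K - v L) + kappa K * v K = b K.
Proof.
move=> solvable.
(* The perturbation is switched off when some kappa(K) is positive. *)
pose m : R := if `[< exists K, 0 < kappa K >] then 0 else 1.
pose op (v : T -> R) K :=
  \sum_L w K L * (v K - v L) + kappa K * v K + m * \sum_L v L.
have op_lin a x y K : op (fun L => a * x L + y L) K = a * op x K + op y K.
  rewrite /op big_split /= -mulr_sumr.
  have -> : \sum_L w K L * (a * x K + y K - (a * x L + y L)) =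
    a * (\sum_L w K L * (x K - x L)) + \sum_L w K L * (y K - y L).
    by rewrite mulr_sumr -big_split; apply: eq_bigr => L _ /=; ring.
  ring.
have sum_flux0 (v : T -> R) : \sum_K \sum_L w K L * (v K - v L) = 0.
  by apply: sum_antisym => K L; rewrite w_sym; ring.
have sum_op (v : T -> R) : (forall K, kappa K = 0) ->
    \sum_K op v K = m * #|T|%:R * \sum_L v L.
  move=> kappa0.
  under eq_bigr do rewrite /op kappa0 mul0r addr0.
  by rewrite big_split /= sum_flux0 add0r sumr_const -mulr_natr; ring.
have kappaP : (exists K, 0 < kappa K) \/ (forall K, kappa K = 0) /\ m = 1.
  rewrite /m; case: asboolP => [|no_kappa]; [by left | right; split => // K].
  apply/eqP; rewrite eq_le kappa_ge0 andbT leNgt; apply/negP => Kgt0.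
  by apply: no_kappa; exists K.
have sum0 (v : T -> R) : \sum_K op v K = 0 -> m * \sum_K v K = 0.
  move=> opv0; case: kappaP => [kap|[kappa0 m1]].
    by rewrite /m asboolT ?mul0r.
  have [T0|T_gt0] := posnP #|T|.
    by rewrite big1 ?mulr0 // => K _; have := card0_eq T0 K; rewrite inE.
  move: opv0; rewrite sum_op // m1 mul1r => /eqP.
  by rewrite mulf_eq0 pnatr_eq0 eqn0Ngt T_gt0 /= => /eqP ->; rewrite mulr0.
have op_inj v : (forall K, op v K = 0) -> forall K, v K = 0.
  move=> opv0.
  have mean0 : m * \sum_K v K = 0 by apply: sum0; rewrite big1.
  have [v_const kv0] : (forall K L, v K = v L) /\ (forall K, kappa K * v K ^+ 2 = 0).
    apply: energy_eq0_constant; rewrite -big_split big1 // => K _ /=.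
    have /= := opv0 K; rewrite /op mean0 addr0 => eqK.
    rewrite (_ : _ + _ = v K * (\sum_L w K L * (v K - v L) + kappa K * v K)).
      by rewrite eqK mulr0.
    by ring.
  move=> K; case: kappaP => [[L kL]|[kappa0 m1]].
    by have /eqP := kv0 L; rewrite mulf_eq0 gt_eqF //= sqrf_eq0 (v_const L K) => /eqP.
  move/eqP: mean0; rewrite m1 mul1r (eq_bigr (fun=> v K)) => [|L _];
    last exact: v_const.
  rewrite sumr_const -mulr_natr mulf_eq0 pnatr_eq0 => /orP[/eqP//|/eqP/card0_eq/(_ K)].
  by rewrite inE.
have [v opvE] := injective_linear_onto op_lin op_inj b.
exists v => K; rewrite -opvE /op.
suff -> : m * \sum_L v L = 0 by rewrite addr0.
case: solvable => [kap|[kappa0 b0]]; first by rewrite /m asboolT ?mul0r.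
by apply: sum0; rewrite -[RHS]b0; apply: eq_bigr => L _.
Qed.

End GraphPoisson.

(** * Cells and their faces *)

Section CellGeometry.
Variables (R : realType) (d : nat) (Omega : set 'rV[R]_d) (M : mac_mesh Omega).
Implicit Types K L : cell M.

Let lo K i : R := (cell_box K).1 ord0 i.
Let hi K i : R := (cell_box K).2 ord0 i.

Lemma cell_extent_eq K L x i :
  box_set (cell_box K) x -> box_set (cell_box L) x ->
  lo K i < hi L i -> lo L i < hi K i -> lo K i = lo L i /\ hi K i = hi L i.
Proof.
move=> Kx Lx KL LK; have [->|neqKL] := eqVneq K L; first by [].
have meet : box_set (cell_box K) `&` box_set (cell_box L) !=set0 by exists x.
by case: (cell_conforming neqKL meet i) => [|eqe|eqe] //; exfalso;
  move: KL LK; rewrite /lo /hi eqe ltxx.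
Qed.

Lemma cell_eq_of_extents K L :
  (forall i, lo K i = lo L i /\ hi K i = hi L i) -> K = L.
Proof.
move=> eqKL; apply: (@cell_box_inj _ _ _ M).
rewrite [LHS]surjective_pairing [RHS]surjective_pairing.
by congr pair; apply/rowP => i; have [] := eqKL i.
Qed.

(** In a conforming mesh, distinct cells have disjoint interiors:
boxes whose open extents meet in every direction have a common point, and then
conformity leaves equality of the extents as the only possibility. *)
Lemma overlapping_cells_eq K L :
  (forall i, lo K i < hi L i /\ lo L i < hi K i) -> K = L.
Proof.
move=> overlap; apply: cell_eq_of_extents => i.
have [KL LK] := overlap i.
pose x : 'rV[R]_d := \row_i Num.max (lo K i) (lo L i).
apply: (@cell_extent_eq K L x) => // j; rewrite mxE le_max ge_max lexx ?orbT /=.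
  by rewrite -/(lo K j) -/(hi K j) !ltW ?cell_box_nondeg //; case: (overlap j).
by rewrite -/(lo K j) -/(hi K j) !ltW ?cell_box_nondeg //; case: (overlap j).
Qed.

Lemma face_endpoints (B : box R d) i s :
  (face B i s).1 ord0 i = (face B i s).2 ord0 i.
Proof. by rewrite !mxE eqxx. Qed.

Lemma face_off_axis (B : box R d) i j s : j != i ->
  (face B i s).1 ord0 j = B.1 ord0 j /\ (face B i s).2 ord0 j = B.2 ord0 j.
Proof. by move=> ji; rewrite !mxE (negPf ji). Qed.

(** A face is degenerate in its own direction only. *)
Lemma face_eq_axis K L i j s t :
  face (cell_box K) i s = face (cell_box L) j t -> i = j.
Proof.
move=> eqF; apply/eqP/negP => /negP ij.
have := face_endpoints (cell_box K) i s; rewrite eqF.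
have [-> ->] := face_off_axis (cell_box L) t ij.
by apply/eqP; rewrite lt_eqF // cell_box_nondeg.
Qed.

Lemma face_eqP K L i s t :
  face (cell_box K) i s = face (cell_box L) i t <->
  (if s then hi K i else lo K i) = (if t then hi L i else lo L i) /\
  forall j, j != i -> lo K j = lo L j /\ hi K j = hi L j.
Proof.
split=> [eqF|[eqi eqj]].
  split=> [|j ji].
    have := congr1 (fun B : box R d => B.1 ord0 i) eqF.
    by rewrite !mxE eqxx /lo /hi; case: s t {eqF} => [] [].
  have [eq1 eq2] := face_off_axis (cell_box K) s ji.
  have [eq3 eq4] := face_off_axis (cell_box L) t ji.
  by split; rewrite /lo /hi -?eq1 -?eq2 eqF ?eq3 ?eq4.
rewrite /face; congr pair; apply/rowP => j; rewrite !mxE;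
  case: eqVneq => ji; try by case: (eqj j ji).
- by move: eqi; rewrite /lo /hi; case: s t => [] [].
- by move: eqi; rewrite /lo /hi; case: s t => [] [].
Qed.

(** Two cells lying on the same side of a common face overlap. *)
Lemma same_side_face_inj K L i s :
  face (cell_box K) i s = face (cell_box L) i s -> K = L.
Proof.
move=> /face_eqP[eqi eqj]; apply: overlapping_cells_eq => j.
have Kj := cell_box_nondeg K j; have Lj := cell_box_nondeg L j.
have [ji|ji] := eqVneq j i; last by have [<- <-] := eqj j ji.
by move: eqi Kj Lj; rewrite ji -/(lo K i) -/(lo L i) -/(hi K i) -/(hi L i);
  case: s => [->|<-].
Qed.

(** By [same_side_face_inj] at most one cell lies beyond a face, so the choice
made by [nbr] is determined; this is what makes [nbr] symmetric. *)
Lemma nbrP K L i s :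
  nbr K i s = Some L <-> face (cell_box L) i (~~ s) = face (cell_box K) i s.
Proof.
rewrite /nbr; split; case: pickP => [L' /eqP eqF'|noL] //.
- by case=> <-.
- by move=> eqF; rewrite (@same_side_face_inj L' L i (~~ s)) // eqF' eqF.
- by move=> eqF; have := noL L; rewrite eqF eqxx.
Qed.

Lemma nbr_sym K L i s : nbr K i s = Some L -> nbr L i (~~ s) = Some K.
Proof. by move=> /nbrP eqF; apply/nbrP; rewrite negbK. Qed.

Lemma side_edge_eqP K L i j s t :
  side_edge K i s = side_edge L j t <->
  face (cell_box K) i s = face (cell_box L) j t.
Proof. by split=> [/(congr1 val)|eqF] //; apply: val_inj. Qed.

Lemma side_edge_nbr K L i s :
  nbr K i s = Some L -> side_edge L i (~~ s) = side_edge K i s.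
Proof. by move=> /nbrP eqF; apply/side_edge_eqP. Qed.

Lemma nbr_extent K L i s j :
  nbr K i s = Some L -> j != i -> extent L j = extent K j.
Proof.
by move=> /nbrP/face_eqP[_ eqj] /eqj[]; rewrite /extent /lo /hi => -> ->.
Qed.

Lemma extent_gt0 K i : 0 < extent K i.
Proof. by rewrite subr_gt0 cell_box_nondeg. Qed.

Lemma vol_gt0 K : 0 < vol K.
Proof. by apply: prodr_gt0 => i _; apply: extent_gt0. Qed.

Lemma area_gt0 K i : 0 < area K i.
Proof. by apply: prodr_gt0 => j _; apply: extent_gt0. Qed.

Lemma dual_vol_gt0 K i s : 0 < dual_vol K i s.
Proof.
rewrite /dual_vol; case: nbr => [L|]; rewrite ?addr0 ?addr_gt0 ?divr_gt0 //;
  exact: vol_gt0.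
Qed.

Lemma nbr_area K L i s : nbr K i s = Some L -> area L i = area K i.
Proof. by move=> nKL; apply: eq_bigr => j /(nbr_extent nKL). Qed.

Lemma nbr_dual_vol K L i s :
  nbr K i s = Some L -> dual_vol L i (~~ s) = dual_vol K i s.
Proof. by move=> nKL; rewrite /dual_vol nKL (nbr_sym nKL) addrC. Qed.

End CellGeometry.

(** * Connectedness of the mesh *)

Section MeshConnected.
Variables (R : realType) (d : nat) (Omega : set 'rV[R]_d) (M : mac_mesh Omega).
Hypotheses (Omega_open : open Omega) (Omega_connected : connected Omega).
Implicit Types K L N : cell M.

Let lo K i : R := (cell_box K).1 ord0 i.
Let hi K i : R := (cell_box K).2 ord0 i.

Definition face_adjacent : rel (cell M) :=
  [rel K L | [exists i, exists s, nbr K i s == Some L]].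

Lemma box_set_closed (B : box R d) : closed (box_set B).
Proof.
have -> : box_set B = \bigcap_(i in [set: 'I_d])
    ((fun x : 'rV[R]_d => x ord0 i) @^-1` [set t | B.1 ord0 i <= t] `&`
     (fun x : 'rV[R]_d => x ord0 i) @^-1` [set t | t <= B.2 ord0 i]).
  apply/seteqP; split => [x Bx i _|x Bx i] /=.
    by have /andP[] := Bx i.
  by have [/= -> ->] := Bx i I.
apply: closed_bigI => i _; apply: closedI.
  by apply: preimage_closed (@closed_ge _ _) => x _; exact: coord_continuous.
by apply: preimage_closed (@closed_le _ _) => x _; exact: coord_continuous.
Qed.

(** The finitely many cells which do not contain x stay at a positive distance
from x, and near x the domain is covered by the cells. *)
Lemma cells_cover_near x : Omega x ->
  exists2 r : R, 0 < r & forall y : 'rV[R]_d, (forall i, `|x ord0 i - y ord0 i| < r) ->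
    exists N, box_set (cell_box N) x /\ box_set (cell_box N) y.
Proof.
move=> Ox.
have stay : \forall y \near x,
    forall N, box_set (cell_box N) y -> box_set (cell_box N) x.
  apply: (@filter_forall _ _ (fun N => [set y | box_set (cell_box N) y -> _])
    _ (nbhs_filter x)) => N.
  have [Nx|Nx] := pselect (box_set (cell_box N) x); first by near=> y.
  have /open_nbhs_nbhs : open_nbhs x (~` box_set (cell_box N)).
    by split => //; apply: closed_openC; apply: box_set_closed.
  by apply: filterS => y Ny /Ny.
have nearO : \forall y \near x, Omega y by apply: open_nbhs_nbhs.
have [r /= r_gt0 ball_r] := (nbhs_ballP _ _).1 (filterI stay nearO).
exists r => // y xy_r.
have [stay_y Oy] :
    (forall N, box_set (cell_box N) y -> box_set (cell_box N) x) /\ Omega y.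
  by apply: ball_r; split => // i j; rewrite ord1; apply: xy_r.
have : closure Omega y by apply: subset_closure.
by rewrite (cell_cover M) => -[N _ Ny]; exists N; split => //; apply: stay_y.
Unshelve. all: by end_near. Qed.

Lemma open_segment_near (a b x r : R) : a < b -> a <= x <= b -> 0 < r ->
  exists y, [/\ a < y, y < b & `|x - y| < r].
Proof.
move=> ab /andP[ax xb] r_gt0; have [xltb|xeqb] := ltP x b.
  exists ((x + Num.min b (x + r)) / 2).
  by split; rewrite ?ltr_norml; case: (leP b (x + r)) => ?; try (apply/andP; split); lra.
exists ((x + Num.max a (x - r)) / 2).
by split; rewrite ?ltr_norml; case: (leP a (x - r)) => ?; try (apply/andP; split); lra.
Qed.

(** The move that changes one direction. Choose a point y close to x whose i-th
coordinate is interior to the extent of L and whose other coordinates are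
interior to those of K. A cell that contains both x and y overlaps L in the
direction i and K in all others, so conformity forces its extents. *)
Lemma mixed_cell x K L i :
  Omega x -> box_set (cell_box K) x -> box_set (cell_box L) x ->
  exists N, [/\ box_set (cell_box N) x,
    forall j, j != i -> lo N j = lo K j /\ hi N j = hi K j &
    lo N i = lo L i /\ hi N i = hi L i].
Proof.
move=> Ox Kx Lx; have [r r_gt0 cover] := cells_cover_near Ox.
pose S j := if j == i then L else K.
have Sx j : box_set (cell_box (S j)) x by rewrite /S; case: ifP.
have /choice[y yP] j : exists y,
    [/\ lo (S j) j < y, y < hi (S j) j & `|x ord0 j - y| < r].
  by apply: open_segment_near => //; [exact: cell_box_nondeg | exact: Sx].
have [N [Nx Ny]] : exists N, box_set (cell_box N) x /\
    box_set (cell_box N) (\row_j y j).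
  by apply: cover => j; rewrite mxE; case: (yP j).
have NS j : lo N j = lo (S j) j /\ hi N j = hi (S j) j.
  have [ya yb _] := yP j.
  have /andP[] := Ny j; rewrite mxE -/(lo N j) -/(hi N j) => yN Ny'.
  apply: cell_extent_eq Nx (Sx j) _ _.
    exact: le_lt_trans yN yb.
  exact: lt_le_trans ya Ny'.
exists N; split => // [j ji|]; first by have := NS j; rewrite /S (negPf ji).
by have := NS i; rewrite /S eqxx.
Qed.

Lemma adjacent_of_extents K N x i :
  box_set (cell_box K) x -> box_set (cell_box N) x ->
  (forall j, j != i -> lo N j = lo K j /\ hi N j = hi K j) ->
  connect face_adjacent K N.
Proof.
move=> Kx Nx eqj; have [->|neqKN] := eqVneq K N; first exact: connect0.
have meet : box_set (cell_box K) `&` box_set (cell_box N) !=set0 by exists x.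
apply: connect1; apply/existsP; exists i; apply/existsP.
case: (cell_conforming neqKN meet i) => [[eq1 eq2]|eqe|eqe].
- suff eqKN : K = N by rewrite eqKN eqxx in neqKN.
  apply: cell_eq_of_extents => j; have [->|ji] := eqVneq j i; first by [].
  by have [] := eqj j ji.
- by exists true; apply/eqP/nbrP/face_eqP.
- by exists false; apply/eqP/nbrP/face_eqP.
Qed.

(** Induction on the number of directions in which the extents of K and L
differ, each step changing one of them with [mixed_cell]. *)
Lemma cells_at_point_connected x K L :
  Omega x -> box_set (cell_box K) x -> box_set (cell_box L) x ->
  connect face_adjacent K L.
Proof.
move=> Ox Kx Lx.
pose diff K' := [set j | (lo K' j != lo L j) || (hi K' j != hi L j)]%SET.
have [n] := ubnP #|diff K|; elim: n K Kx => // n IHn K Kx le_n.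
have [diff0|[i iK]] := set_0Vmem (diff K).
  rewrite (_ : K = L) ?connect0 //; apply: cell_eq_of_extents => j.
  have : j \notin diff K by rewrite diff0 inE.
  by rewrite inE negb_or !negbK => /andP[/eqP ? /eqP ?].
have [N [Nx eqK eqL]] := mixed_cell i Ox Kx Lx.
apply: connect_trans (adjacent_of_extents Kx Nx eqK) (IHn N Nx _).
rewrite ltnS in le_n; apply: leq_trans le_n; apply: proper_card.
apply/properP; split; last first.
  by exists i => //; rewrite inE eqL.1 eqL.2 !eqxx.
apply/fintype.subsetP => j; rewrite !inE; have [->|ji] := eqVneq j i.
  by rewrite eqL.1 eqL.2 !eqxx.
by have [-> ->] := eqK j ji.
Qed.

(** The centre of a cell belongs to the closure of Omega and the cell is a
neighbourhood of it. *)
Lemma cell_meets_Omega K : exists2 x, Omega x & box_set (cell_box K) x.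
Proof.
pose c : 'rV[R]_d := \row_i ((lo K i + hi K i) / 2).
have Kc i : lo K i < c ord0 i < hi K i.
  have : lo K i < hi K i := cell_box_nondeg K i.
  by rewrite mxE => ?; apply/andP; split; lra.
have : closure Omega c.
  by rewrite (cell_cover M); exists K => // i; have /andP[/ltW -> /ltW ->] := Kc i.
case/(_ (box_set (cell_box K))) => [|x [Ox Kx]]; last by exists x.
have : nbhs c [set y : 'rV[R]_d | forall i, lo K i < y ord0 i < hi K i].
  apply: (@filter_forall _ _ (fun i => [set y : 'rV[R]_d | lo K i < y ord0 i < hi K i])
    _ (nbhs_filter c)) => i.
  have : nbhs (c ord0 i) [set t | lo K i < t < hi K i].
    by have := near_in_itvoo (Kc i); apply: filterS => t; rewrite inE.
  exact: coord_continuous.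
by apply: filterS => y Ky i; have /andP[/ltW -> /ltW ->] := Ky i.
Qed.

(** The cells reachable from K and the other ones form two closed sets. They
cover Omega and, by [cells_at_point_connected], share no point of it; a cell
outside the component of K would make both of them meet Omega. *)
Theorem mesh_connected K L : connect face_adjacent K L.
Proof.
apply/negPn/negP => KL.
pose cells_in (P : pred (cell M)) := \bigcup_(N in [set` P]) box_set (cell_box N).
have cells_closed P : closed (cells_in P).
  by apply: closed_bigcup => // N _; exact: box_set_closed.
pose P : pred (cell M) := connect face_adjacent K.
have Omega_cover x : Omega x -> ~ cells_in (predC P) x -> cells_in P x.
  move=> /(@subset_closure _ Omega); rewrite (cell_cover M) => -[N _ Nx] noC.
  exists N => //=; apply/negPn/negP => PN; apply: noC; by exists N.
have disj x : Omega x -> cells_in P x -> ~ cells_in (predC P) x.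
  move=> Ox [N PN Nx] [N' /negP PN' N'x]; apply: PN'.
  exact: connect_trans PN (cells_at_point_connected Ox Nx N'x).
have [x Ox Kx] := cell_meets_Omega K; have [y Oy Ly] := cell_meets_Omega L.
have allP : Omega `&` cells_in P = Omega.
  apply: Omega_connected.
  - by exists x; split => //; exists K => //=; exact: connect0.
  - exists (~` cells_in (predC P)); first exact: closed_openC.
    by apply/seteqP; split => z [Oz]; [move/(disj z Oz)|move/(Omega_cover z Oz)].
  - by exists (cells_in P).
have : (Omega `&` cells_in P) y by rewrite allP.
by case=> _ /(disj y Oy); apply; exists L.
Qed.

End MeshConnected.

(** * Sums and fields over the edges *)

Section EdgeSums.
Variables (R : realType) (d : nat) (Omega : set 'rV[R]_d) (M : mac_mesh Omega).
Implicit Types (K L : cell M) (c : cell M -> 'I_d -> bool -> R).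

(** Coefficients carried by the sides of the cells, seen as a matrix indexed by
pairs of cells, so that the scheme becomes a system on the graph of the cells. *)
Definition pair_weight c K L : R :=
  \sum_i \sum_s (if nbr K i s == Some L then c K i s else 0).

Lemma pair_weightE c (g : cell M -> R) K :
  \sum_L pair_weight c K L * g L =
  \sum_i \sum_s (if nbr K i s is Some L then c K i s * g L else 0).
Proof.
under eq_bigr do rewrite mulr_suml.
rewrite exchange_big; apply: eq_bigr => i _ /=.
under eq_bigr do rewrite mulr_suml.
rewrite exchange_big; apply: eq_bigr => s _ /=.
case nKL : (nbr K i s) => [L|]; last by rewrite big1 // => L _; rewrite mul0r.
rewrite (bigD1 L) //= eqxx big1 ?addr0 // => N NL.
by rewrite ifF ?mul0r //; apply/eqP => -[LN]; rewrite LN eqxx in NL.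
Qed.

Lemma pair_weight_swap c (a : R) :
  (forall K L i s, nbr K i s = Some L -> c L i (~~ s) = a * c K i s) ->
  forall K L, pair_weight c L K = a * pair_weight c K L.
Proof.
move=> cE K L; rewrite mulr_sumr; apply: eq_bigr => i _.
rewrite (reindex_inj (inv_inj negbK)) mulr_sumr; apply: eq_bigr => s _ /=.
have [nKL|nKL] := eqVneq (nbr K i s) (Some L).
  by rewrite (nbr_sym nKL) eqxx; apply: cE.
rewrite mulr0 ifF //; apply/eqP => nLK; case/eqP: nKL.
by have := nbr_sym nLK; rewrite negbK.
Qed.

(** The two contributions of each internal edge cancel. *)
Lemma conservative_sum0 c :
  (forall K i s, nbr K i s = None -> c K i s = 0) ->
  (forall K L i s, nbr K i s = Some L -> c L i (~~ s) = - c K i s) ->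
  \sum_K \sum_i \sum_s c K i s = 0.
Proof.
move=> c_ext c_anti.
rewrite -[RHS](@sum_antisym _ _ (pair_weight c)) => [|K L]; last first.
  rewrite (@pair_weight_swap c (-1)) ?mulN1r // => K' L' i s nKL.
  by rewrite mulN1r; apply: c_anti.
apply: eq_bigr => K _.
transitivity (\sum_L pair_weight c K L * 1); last first.
  by apply: eq_bigr => L _; rewrite mulr1.
rewrite pair_weightE; apply: eq_bigr => i _; apply: eq_bigr => s _.
by case nKs : (nbr K i s) => [L|]; [rewrite mulr1 | exact: c_ext].
Qed.

(** An internal edge determines its direction and the cell of which it is the
upper face, and it is never an external edge; prescribing one value for each
triple (K, L, i) is therefore consistent. *)
Lemma edge_field_exists (g : cell M -> cell M -> 'I_d -> R) :
  exists v : vector_field M, in_HE0 v /\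
    forall K L i, nbr K i true = Some L -> v (side_edge K i true) = g K L i.
Proof.
(* The pairs (K, i) such that sigma is the upper face of K in the direction i
   and is internal; there is at most one. *)
pose owner (sigma : edge M) (x : cell M * 'I_d) :=
  (nbr x.1 x.2 true != None) && (side_edge x.1 x.2 true == sigma).
pose v : vector_field M := [ffun sigma =>
  if [pick x | owner sigma x] is Some x then
    if nbr x.1 x.2 true is Some L then g x.1 L x.2 else 0
  else 0].
exists v; split=> [K i s nKs|K L i nKL]; rewrite ffunE; case: pickP => //=.
- move=> [N j] /andP[/= nN /eqP/side_edge_eqP eqF].
  have ij := face_eq_axis eqF; rewrite ij in nN eqF.
  case: s nKs eqF => nKs eqF.
    by rewrite (same_side_face_inj eqF) nKs in nN.
  have : nbr K i false = Some N by apply/nbrP.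
  by rewrite nKs.
- move=> [N j] /andP[/= nN /eqP/side_edge_eqP eqF].
  have ij := face_eq_axis eqF; rewrite ij in eqF *.
  by rewrite (same_side_face_inj eqF) nKL.
- by move/(_ (K, i)); rewrite /owner /= nKL eqxx.
Qed.

End EdgeSums.

(** * The linear system for the potential *)

Section EliminatedSystem.
Variables (R : realType) (d : nat) (Omega : set 'rV[R]_d) (M : mac_mesh Omega).
Variables (GammaD : set 'rV[R]_d) (phiD : 'rV[R]_d -> R).
Variables (gamma eps dt : R) (eta : edge M -> R).
Variables (rho : scalar_field M) (u : vector_field M).
Hypotheses (eps_gt0 : 0 < eps) (dt_gt0 : 0 < dt).
Hypothesis eta_gt0 : forall K i s, nbr K i s <> None -> 0 < eta (side_edge K i s).
Implicit Types (K L : cell M).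

Lemma nsgnN s : nsgn R (~~ s) = - nsgn R s.
Proof. by case: s; rewrite /= ?opprK. Qed.

Lemma nsgn_sqr s : nsgn R s * nsgn R s = 1.
Proof. by case: s; rewrite /= ?mulrNN mulr1. Qed.

Lemma interface_density_sym K L i s : nbr K i s = Some L ->
  interface_density gamma rho L i (~~ s) = interface_density gamma rho K i s.
Proof.
move=> nKL; rewrite /interface_density nKL (nbr_sym nKL) eq_sym.
case: eqVneq => [->//|_]; rewrite -opprB -[X in _ / X]opprB.
by rewrite invrN mulrNN.
Qed.

Lemma pderiv_int_sym (q : cell M -> R) K L i s : nbr K i s = Some L ->
  pderiv_int q L i (~~ s) = pderiv_int q K i s.
Proof.
move=> nKL; rewrite /pderiv_int nKL (nbr_sym nKL) /edge_diff.
by rewrite (nbr_area nKL) (nbr_dual_vol nKL) nsgnN; ring.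
Qed.

Lemma mass_flux_antisym (phi : scalar_field M) K L i s : nbr K i s = Some L ->
  mass_flux gamma dt eta rho u phi L i (~~ s) =
  - mass_flux gamma dt eta rho u phi K i s.
Proof.
move=> nKL; rewrite /mass_flux /stabilisation /normal_comp nKL (nbr_sym nKL).
rewrite (nbr_area nKL) (side_edge_nbr nKL) (interface_density_sym nKL).
by rewrite !(pderiv_int_sym _ nKL) nsgnN; ring.
Qed.

(** The coefficient of phi_K - phi_L after elimination of the density: the first
part comes from the Poisson equation, the second one from the stabilisation. *)
Definition transmissivity K i s : R :=
  area K i ^+ 2 / dual_vol K i s *
  (eps ^+ 2 + dt ^+ 2 * eta (side_edge K i s) *
              interface_density gamma rho K i s ^+ 2).

(** The part of the mass flux that is known at time n. The fluxes are affine in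
the potential, so it is their value at the zero potential. *)
Definition explicit_flux := mass_flux gamma dt eta rho u [ffun=> 0].

Definition dirichlet_weight K i s : R :=
  if (nbr K i s == None) && `[< face_relint (cell_box K) i s `<=` GammaD >]
  then eps ^+ 2 * (area K i ^+ 2 / dual_vol K i s) else 0.

Lemma transmissivity_gt0 K i s : nbr K i s <> None -> 0 < transmissivity K i s.
Proof.
move=> nK; have eta_K := eta_gt0 nK.
rewrite mulr_gt0 ?divr_gt0 ?exprn_gt0 ?area_gt0 ?dual_vol_gt0 //.
rewrite ltr_pwDl ?exprn_gt0 // mulr_ge0 ?sqr_ge0 //.
by rewrite mulr_ge0 ?sqr_ge0 // ltW.
Qed.

Lemma dirichlet_weight_ge0 K i s : 0 <= dirichlet_weight K i s.
Proof.
rewrite /dirichlet_weight; case: ifP => // _.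
by rewrite mulr_ge0 ?sqr_ge0 // divr_ge0 ?sqr_ge0 // ltW ?dual_vol_gt0.
Qed.

(** The combination of the Poisson equation and the mass balance, side by side:
an explicit part minus the contribution of the graph Laplacian. *)
Lemma side_contribution (phi : scalar_field M) K i s :
  eps ^+ 2 * (area K i * (pderiv GammaD phiD phi K i s * nsgn R s)) +
    dt * mass_flux gamma dt eta rho u phi K i s =
  dt * explicit_flux K i s + dirichlet_weight K i s * edge_mean phiD K i s -
  ((if nbr K i s is Some L then transmissivity K i s * (phi K - phi L) else 0) +
   dirichlet_weight K i s * phi K).
Proof.
(* The identity is polynomial once the square of the sign of the normal is
   known to be 1. *)
have sgn2 := nsgn_sqr s.
rewrite /explicit_flux /mass_flux /stabilisation /pderiv /pderiv_int /outer_value.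
rewrite /dirichlet_weight /edge_diff /transmissivity.
case nKs : (nbr K i s) => [L|] /=; last first.
  by case: asboolP => _; move: (nsgn R s) sgn2 => z sgn2; ring: sgn2.
rewrite !ffunE; move: (nsgn R s) sgn2 => z sgn2; ring: sgn2.
Qed.

Lemma poisson_of_eliminated (phi : scalar_field M) (rho' : scalar_field M) :
  (forall K, vol K * (rho' K - rho K) =
     - (dt * \sum_i \sum_s mass_flux gamma dt eta rho u phi K i s)) ->
  (forall K, \sum_L pair_weight transmissivity K L * (phi K - phi L) +
     (\sum_i \sum_s dirichlet_weight K i s) * phi K =
     \sum_i \sum_s (dt * explicit_flux K i s +
        dirichlet_weight K i s * edge_mean phiD K i s) - vol K * (rho K - 1)) ->
  poisson GammaD phiD eps rho' phi.
Proof.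
move=> massE sysE K; have vK := vol_gt0 K.
apply: (mulfI (lt0r_neq0 vK)); rewrite /laplacian.
have -> : vol K * (rho' K - 1) = vol K * (rho' K - rho K) + vol K * (rho K - 1).
  by ring.
rewrite massE.
have -> : vol K * (rho K - 1) = \sum_i \sum_s (dt * explicit_flux K i s +
        dirichlet_weight K i s * edge_mean phiD K i s) -
   (\sum_L pair_weight transmissivity K L * (phi K - phi L) +
     (\sum_i \sum_s dirichlet_weight K i s) * phi K) by rewrite sysE; ring.
rewrite (pair_weightE _ (fun L => phi K - phi L)).
rewrite mulrCA mulVKf ?lt0r_neq0 //; apply/eqP.
rewrite addrC -subr_eq opprK; apply/eqP.
rewrite mulr_suml -big_split -sumrB !mulr_sumr -big_split; apply: eq_bigr => i _ /=.
rewrite mulr_suml -big_split -sumrB !mulr_sumr -big_split; apply: eq_bigr => s _ /=.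
exact: side_contribution.
Qed.

Hypotheses (Omega_open : open Omega) (Omega_connected : connected Omega).

(** The weights are symmetric because every factor of the transmissivity is
attached to the edge rather than to the cell from which it is seen. Without
Dirichlet faces the explicit fluxes cancel in the sum of the data, and what
remains is the total mass of rho minus the total volume. *)
Lemma eliminated_system_solvable :
  (exists K i s, dirichlet_side GammaD (M := M) K i s) \/
    \sum_K vol K * rho K = \sum_(K : cell M) vol K ->
  exists phi : scalar_field M, forall K,
    \sum_L pair_weight transmissivity K L * (phi K - phi L) +
      (\sum_i \sum_s dirichlet_weight K i s) * phi K =
    \sum_i \sum_s (dt * explicit_flux K i s +
      dirichlet_weight K i s * edge_mean phiD K i s) - vol K * (rho K - 1).
Proof.
move=> wellposed.
pose w := pair_weight transmissivity.
pose kappa K := \sum_i \sum_s dirichlet_weight K i s.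
pose b K := \sum_i \sum_s (dt * explicit_flux K i s +
      dirichlet_weight K i s * edge_mean phiD K i s) - vol K * (rho K - 1).
have w_sym K L : w K L = w L K.
  rewrite /w (@pair_weight_swap _ _ _ _ transmissivity 1) ?mul1r //.
  move=> {K L} K L i s nKL; rewrite mul1r /transmissivity (nbr_area nKL).
  by rewrite (nbr_dual_vol nKL) (side_edge_nbr nKL) (interface_density_sym nKL).
(* Only sides with a neighbour count, where eta is positive. *)
have term_ge0 K L i s : 0 <= (if nbr K i s == Some L then transmissivity K i s else 0).
  by case: eqP => // nKL; apply/ltW/transmissivity_gt0; rewrite nKL.
have w_ge0 K L : 0 <= w K L by apply: sumr_ge0 => i _; apply: sumr_ge0.
have kappa_ge0 K : 0 <= kappa K.
  by apply: sumr_ge0 => i _; apply: sumr_ge0 => s _; apply: dirichlet_weight_ge0.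
have w_nbr_gt0 K L i s : nbr K i s = Some L -> 0 < w K L.
  move=> nKL; rewrite /w /pair_weight (bigD1 i) //= (bigD1 s) //= nKL eqxx.
  rewrite -addrA ltr_pwDl ?transmissivity_gt0 ?nKL // addr_ge0 ?sumr_ge0 //.
  by move=> j _; apply: sumr_ge0.
have w_conn (v : cell M -> R) :
    (forall K L, 0 < w K L -> v K = v L) -> forall K L, v K = v L.
  move=> v_const K L.
  have /connectP[p pth ->] := mesh_connected Omega_open Omega_connected K L.
  elim: p K pth => //= N p IHp K /andP[/existsP[i /existsP[s /eqP nKN]] pth].
  by rewrite -IHp // (v_const K N) // (w_nbr_gt0 _ _ _ _ nKN).
have [|v vE] := @graph_poisson R (cell M) w kappa w_sym w_ge0 kappa_ge0 w_conn b.
  have [[K [i [s [nKs onD]]]]|noD] :=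
      pselect (exists K i s, dirichlet_side GammaD (M := M) K i s).
    left; exists K; rewrite /kappa (bigD1 i) //= (bigD1 s) //= -addrA ltr_pwDl //.
      rewrite /dirichlet_weight nKs eqxx /= asboolT // mulr_gt0 ?exprn_gt0 //.
      by rewrite divr_gt0 ?exprn_gt0 ?area_gt0 ?dual_vol_gt0.
    rewrite addr_ge0 ?sumr_ge0 // => *; rewrite ?sumr_ge0 // => *;
      exact: dirichlet_weight_ge0.
  have weight0 K i s : dirichlet_weight K i s = 0.
    rewrite /dirichlet_weight; case: ifP => // /andP[/eqP nKs /asboolP onD].
    by exfalso; apply: noD; exists K, i, s.
  case: wellposed => [//|mass_eq].
  right; split=> [K|]; first by rewrite /kappa big1 // => i _; rewrite big1.
  have bE K : b K = dt * (\sum_i \sum_s explicit_flux K i s) -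
      (vol K * rho K - vol K).
    rewrite /b; congr (_ - _); last by ring.
    rewrite mulr_sumr; apply: eq_bigr => i _; rewrite mulr_sumr.
    by apply: eq_bigr => s _; rewrite weight0 mul0r addr0.
  rewrite (eq_bigr _ (fun K _ => bE K)) sumrB -mulr_sumr sumrB mass_eq subrr subr0.
  rewrite conservative_sum0 ?mulr0 // => [K i s nKs|K L i s nKL].
    by rewrite /explicit_flux /mass_flux nKs.
  exact: mass_flux_antisym.
exists (finfun v) => K; rewrite -[RHS]vE ffunE; congr (_ + _).
by apply: eq_bigr => L _; rewrite ffunE.
Qed.

(** The density is read off from the mass balance; the eliminated system is
what makes the Poisson equation hold for it. *)
Lemma density_potential_exist :
  (exists K i s, dirichlet_side GammaD (M := M) K i s) \/
    \sum_K vol K * rho K = \sum_(K : cell M) vol K ->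
  exists rho' phi : scalar_field M,
    mass_balance gamma dt eta rho u rho' phi /\ poisson GammaD phiD eps rho' phi.
Proof.
move=> /eliminated_system_solvable[phi phiE].
pose rho' : scalar_field M := [ffun K => rho K -
  dt * ((vol K)^-1 * \sum_i \sum_s mass_flux gamma dt eta rho u phi K i s)].
exists rho', phi; split=> [K|].
  rewrite ffunE; have dt_neq0 := lt0r_neq0 dt_gt0.
  have vol_neq0 := lt0r_neq0 (vol_gt0 K); field.
  by rewrite dt_neq0 vol_neq0.
apply: poisson_of_eliminated phiE => K; rewrite ffunE.
by have vol_neq0 := lt0r_neq0 (vol_gt0 K); field.
Qed.

End EliminatedSystem.

(** * The scheme *)

(** The momentum balance contains the new velocity only in the term
rho'_(D_sigma) u'_sigma, so it is solved edge by edge by a division. *)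
Lemma velocity_exists (R : realType) (d : nat) (Omega : set 'rV[R]_d)
    (M : mac_mesh Omega) (gamma dt alpha C : R) (eta : edge M -> R)
    (rho rho' : scalar_field M) (u : vector_field M) (phi : scalar_field M) :
  0 < dt -> (forall K i s, nbr K i s <> None -> dual_average rho' K i s != 0) ->
  exists2 u' : vector_field M, in_HE0 u' &
    momentum_balance gamma dt alpha C eta rho u rho' u' phi.
Proof.
move=> dt_gt0 rho'_neq0.
pose p K := pressure gamma (rho K).
have [u' [u'0 u'E]] := @edge_field_exists R d Omega M (fun K L i =>
  (dt * (interface_density gamma rho K i true *
     pderiv_int (fun K' => phi K' - Lambda gamma dt alpha C rho u K') K i true -
     pderiv_int p K i true -
     (dual_vol K i true)^-1 * convection gamma dt eta rho u phi K L i) +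
   dual_average rho K i true * u (side_edge K i true)) /
  dual_average rho' K i true).
exists u' => // K L i nKL /=; rewrite (u'E K L i nKL).
have avg_neq0 : dual_average rho' K i true != 0 by apply: rho'_neq0; rewrite nKL.
have dt_neq0 := lt0r_neq0 dt_gt0.
rewrite -/p; field.
by rewrite dt_neq0 avg_neq0 lt0r_neq0 ?dual_vol_gt0.
Qed.

Theorem theorem4p7 (R : realType) (d : nat) (hd : d = 2%N \/ d = 3%N)
  (Omega : set 'rV[R]_d) (hopen : open Omega) (hbounded : bounded_set Omega)
  (hconnected : connected Omega)
  (M : mac_mesh Omega)
  (GammaD GammaN : set 'rV[R]_d) (hGamma : boundary_partition M GammaD GammaN)
  (phiD : 'rV[R]_d -> R) (hphiD : Linfty_H1 M phiD)
  (gamma : R) (hgamma : 1 <= gamma)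
  (eps : R) (heps : 0 < eps <= 1)
  (dt : R) (hdt : 0 < dt)
  (alpha : R) (halpha : 2 <= alpha)
  (C : R) (hC : 0 < C)
  (eta : edge M -> R)
  (heta : forall K i s, nbr K i s <> None -> 0 < eta (side_edge K i s))
  (rho_n : scalar_field M) (u_n : vector_field M) (phi_n : scalar_field M)
  (hrho_n : forall K, 0 < rho_n K) (hu_n : in_HE0 u_n)
  (* the discrete Poisson problem is well posed *)
  (hpoisson : (exists K i s, dirichlet_side GammaD (M := M) K i s) \/
              \sum_K vol K * rho_n K = \sum_(K : cell M) vol K)
  (* u^{n+1} can be recovered from the momentum: no dual density vanishes *)
  (hdual : forall rho phi : scalar_field M,
     mass_balance gamma dt eta rho_n u_n rho phi ->
     poisson GammaD phiD eps rho phi ->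
     forall K i s, nbr K i s <> None -> dual_average rho K i s != 0) :
  exists (rho : scalar_field M) (u : vector_field M) (phi : scalar_field M),
    [/\ in_HE0 u,
        mass_balance gamma dt eta rho_n u_n rho phi,
        momentum_balance gamma dt alpha C eta rho_n u_n rho u phi &
        poisson GammaD phiD eps rho phi].
Proof.
have [eps_gt0 _] := andP heps.
have [rho [phi [mass pois]]] : exists rho phi : scalar_field M,
    mass_balance gamma dt eta rho_n u_n rho phi /\ poisson GammaD phiD eps rho phi.
  exact: density_potential_exist.
have [u u0 mom] := velocity_exists gamma alpha C eta rho_n u_n phi hdt
  (hdual rho phi mass pois).
by exists rho, u, phi.
Qed.
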